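(* For each real number $\alpha\ge 0$ there exists a finite constant $\lambda^*=\lambda^*(\alpha)>0$ such that the boundary value problem $$-U''(x)=\frac{\lambda}{[1-U(x)]^2\left\{1+\alpha\int_{-1}^{1}[1-U(y)]^{-1}\,dy\right\}^2},\quad x\in(-1,1),$$ $$U'(1)+U(1)=0,\qquad -U'(-1)+U(-1)=0,$$ with parameter $\lambda>0$, has exactly two solutions when $\lambda\in(0,\lambda^* )$, exactly one solution when $\lambda=\lambda^*$, and no solution when $\lambda>\lambda^*$.
   Context: Here $\lambda$ is a positive constant. A solution means a classical solution, i.e. a function $U\in C^2([-1,1])$ satisfying the equation and the boundary conditions, with $0<U(x)<1$ for all $x\in[-1,1]$. *)

(* Defs.v *)
From Stdlib Require Import Reals.
From Coquelicot Require Import Coquelicot.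
Open Scope R_scope.

Definition dom (x : R) : Prop := -1 <= x <= 1.

(* Elements of C^2([-1,1]) are represented by functions on R, of which only the
   values on [-1,1] matter; [D_in] and [continue_in] are relative to [-1,1], so
   that they are one-sided at the endpoints.  On [-1,1] the functions [dU] and
   [ddU] are uniquely determined by [U]. *)
Definition C2_with (U dU ddU : R -> R) : Prop :=
  forall x : R, dom x ->
    D_in U dU dom x /\ D_in dU ddU dom x /\ continue_in ddU dom x.

Definition is_solution (alpha lambda : R) (U : R -> R) : Prop :=
  exists dU ddU : R -> R,
    C2_with U dU ddU /\
    (forall x : R, dom x -> 0 < U x < 1) /\
    (forall x : R, -1 < x < 1 ->
      - ddU x =
        lambda / ((1 - U x) ^ 2 *
                  (1 + alpha * RInt (fun y : R => / (1 - U y)) (-1) 1) ^ 2)) /\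
    dU 1 + U 1 = 0 /\
    - dU (-1) + U (-1) = 0.

Definition eq_on_dom (U V : R -> R) : Prop := forall x : R, dom x -> U x = V x.

(* Solutions are counted as functions on [-1,1], i.e. up to [eq_on_dom]. *)
Definition no_solution (S : (R -> R) -> Prop) : Prop :=
  forall U : R -> R, ~ S U.

Definition exactly_one_solution (S : (R -> R) -> Prop) : Prop :=
  exists U : R -> R, S U /\ forall V : R -> R, S V -> eq_on_dom V U.

Definition exactly_two_solutions (S : (R -> R) -> Prop) : Prop :=
  exists U1 U2 : R -> R,
    S U1 /\ S U2 /\ ~ eq_on_dom U1 U2 /\
    forall V : R -> R, S V -> eq_on_dom V U1 \/ eq_on_dom V U2.

(* Main.v *)
Require Import Defs.
From Stdlib Require Import Reals Lra.
From Coquelicot Require Import Coquelicot.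
Open Scope R_scope.

(** Put [w = 1 - U].  The nonlocal factor is a constant for each solution, so
    [w'' = mu / w^2] with [mu > 0], together with [w(1) + w'(1) = 1] and
    [w(-1) - w'(-1) = 1].  This equation integrates explicitly: if [m] is the
    minimum of [w], attained at [x0], then [w = m * cosh(sigma/2)^2], where
    [sigma + sinh sigma] is the affine function [c * (x - x0)] and
    [mu = m^3 * c^2 / 8].  Both boundary conditions then say that one strictly
    increasing function takes the value 1 at [sigma(1)] and at [- sigma(-1)];
    hence [x0 = 0], and the solutions form a curve with the single parameter
    [s = sigma(1) > 0].  On it [c = s + sinh s = stretch s],
    [m = 1 / robin s], the integral of [1 / w] is [4 * s / (m * c)], and
    therefore [lambda = load alpha s] with
    [load alpha s = (stretch s / robin s + 4 * alpha * s)^2 / (8 * robin s)].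
    So solutions for [lambda] correspond to positive roots of
    [load alpha s = lambda] ([deflection_solution], [solution_is_deflection],
    [deflection_distinct]).

    It remains to see that [load alpha] rises from 0 to a maximum and then
    decreases to 0.  Its derivative is a positive function times
    [local_slope + 2 * alpha * nonlocal_slope], and with the normalisation
    chosen here both slopes are strictly decreasing on the half-line, for every
    [alpha] at once; hence the derivative changes sign exactly once
    ([load_unimodal]).  The derivatives of the two slopes are, up to positive
    factors, polynomials in [s], [sinh s], [cosh s], whose signs follow from a few elementary
    inequalities such as [s < sinh s < s * cosh s] and
    [s^3 / 3 < s * cosh s - sinh s].  The value [lambda_star] is the maximum of
    [load alpha]. *)

(** * Monotonicity from derivatives and hyperbolic inequalities *)

Lemma increasing_of_derive (f df : R -> R) (x y : R) :
  (forall t, x <= t <= y -> is_derive f t (df t)) ->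
  (forall t, x < t < y -> 0 < df t) ->
  x < y -> f x < f y.
Proof.
intros Hd Hpos Hxy.
destruct (MVT_cor2 f df x y Hxy) as [c [Hc Hin]].
- intros c Hc; apply is_derive_Reals, Hd, Hc.
- specialize (Hpos c Hin). nra.
Qed.

Lemma positive_of_derive (f df : R -> R) :
  (forall t, is_derive f t (df t)) -> f 0 = 0 ->
  (forall t, 0 < t -> 0 < df t) ->
  forall x, 0 < x -> 0 < f x.
Proof.
intros Hd H0 Hpos x Hx. rewrite <- H0.
apply increasing_of_derive with df; auto.
intros t Ht; apply Hpos; lra.
Qed.

Lemma sinh_sq (x : R) : sinh x ^ 2 = cosh x ^ 2 - 1.
Proof.
unfold sinh, cosh. rewrite exp_Ropp. field. apply Rgt_not_eq, exp_pos.
Qed.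

Lemma sinh_pos (x : R) : 0 < x -> 0 < sinh x.
Proof. intros Hx. rewrite <- sinh_0. now apply sinh_lt. Qed.

Lemma cosh_pos (x : R) : 0 < cosh x.
Proof.
unfold cosh. generalize (exp_pos x) (exp_pos (- x)). lra.
Qed.

Lemma sinh_opp (x : R) : sinh (- x) = - sinh x.
Proof. unfold sinh. rewrite Ropp_involutive. field. Qed.

Lemma cosh_opp (x : R) : cosh (- x) = cosh x.
Proof. unfold cosh. rewrite Ropp_involutive. field. Qed.

Ltac derive := auto_derive; [repeat split; auto | try (simpl; ring)].

Lemma cosh_gt_1 (x : R) : 0 < x -> 1 < cosh x.
Proof.
intros Hx.
enough (0 < cosh x - 1) by lra.
apply (positive_of_derive (fun t => cosh t - 1) sinh); auto.
- intros t. derive.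
- rewrite cosh_0; lra.
- apply sinh_pos.
Qed.

Lemma cosh_ge_1 (x : R) : 1 <= cosh x.
Proof. generalize (sinh_sq x) (cosh_pos x). nra. Qed.

Lemma sinh_gt_id (x : R) : 0 < x -> x < sinh x.
Proof.
intros Hx.
enough (0 < sinh x - x) by lra.
apply (positive_of_derive (fun t => sinh t - t) (fun t => cosh t - 1)); auto.
- intros t. derive.
- rewrite sinh_0; lra.
- intros t Ht. generalize (cosh_gt_1 t Ht). lra.
Qed.

Lemma cosh_gt_quadratic (x : R) : 0 < x -> 1 + x ^ 2 / 2 < cosh x.
Proof.
intros Hx.
enough (0 < cosh x - 1 - x ^ 2 / 2) by lra.
apply (positive_of_derive (fun t => cosh t - 1 - t ^ 2 / 2)
         (fun t => sinh t - t)); auto.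
- intros t. auto_derive; auto. field.
- rewrite cosh_0; lra.
- intros t Ht. generalize (sinh_gt_id t Ht). lra.
Qed.

Lemma sinh_lt_mul_cosh (x : R) : 0 < x -> sinh x < x * cosh x.
Proof.
intros Hx.
enough (0 < x * cosh x - sinh x) by lra.
apply (positive_of_derive (fun t => t * cosh t - sinh t)
         (fun t => t * sinh t)); auto.
- intros t. derive.
- rewrite sinh_0; lra.
- intros t Ht. apply Rmult_lt_0_compat; [|apply sinh_pos]; auto.
Qed.

Lemma mul_cosh_sub_sinh_gt_cube (x : R) :
  0 < x -> x ^ 3 / 3 < x * cosh x - sinh x.
Proof.
intros Hx.
enough (0 < x * cosh x - sinh x - x ^ 3 / 3) by lra.
apply (positive_of_derive (fun t => t * cosh t - sinh t - t ^ 3 / 3)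
         (fun t => t * (sinh t - t))); auto.
- intros t. auto_derive; auto. field.
- rewrite sinh_0; lra.
- intros t Ht. apply Rmult_lt_0_compat; auto.
  generalize (sinh_gt_id t Ht). lra.
Qed.

Lemma mul_cosh_sub_sinh_gt_sinh_sub_id (x : R) :
  0 < x -> 2 * (sinh x - x) < x * cosh x - sinh x.
Proof.
intros Hx.
enough (0 < x * cosh x - sinh x - 2 * (sinh x - x)) by lra.
apply (positive_of_derive (fun t => t * cosh t - sinh t - 2 * (sinh t - t))
         (fun t => t * sinh t - 2 * (cosh t - 1))); auto.
- intros t. derive.
- rewrite sinh_0; lra.
- apply (positive_of_derive _ (fun t => t * cosh t - sinh t)).
  + intros t. derive.
  + rewrite cosh_0; lra.
  + intros t Ht. generalize (sinh_lt_mul_cosh t Ht). lra.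
Qed.

(** * The load along the curve of solutions *)

(** The substitution that linearises [w'' = mu / w^2]: along a solution
    [w = m * cosh(sigma/2)^2], the quantity [stretch sigma] is affine in [x]. *)
Definition stretch (s : R) : R := s + sinh s.
(** The value of [w(1) + w'(1)] when the minimum of [w] is scaled to 1 and
    [sigma(1) = s]. *)
Definition robin (s : R) : R := cosh s + s * sinh s / (2 * (1 + cosh s)).
(** The parameter [lambda] of the symmetric solution with [sigma(1) = s]. *)
Definition load (alpha s : R) : R :=
  (stretch s / robin s + 4 * alpha * s) ^ 2 / (8 * robin s).

(** The two parts of the sign-determining factor of the derivative of
    [load alpha]: the first is the one for [alpha = 0], the second comes from
    the nonlocal term.  The derivative fixes the sum only up to a positive
    factor; the denominators are chosen to make both parts decreasing, which
    the numerator of [nonlocal_slope] is not.  The denominator of the first is [2 * (1 + cosh s) * robin s]. *)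
Definition local_slope (s : R) : R :=
  ((1 + cosh s) * (9 / 2 + cosh s / 2 - cosh s ^ 2)
     - s * sinh s * (5 + 2 * cosh s) - 3 / 2 * s ^ 2)
  / (2 * cosh s + 2 * cosh s ^ 2 + s * sinh s).
Definition nonlocal_slope (s : R) : R :=
  (2 * cosh s * (1 + cosh s) - s * sinh s * (cosh s + 1 / 2) - s ^ 2 / 2)
  / (1 + cosh s).
Definition load_slope (alpha s : R) : R :=
  local_slope s + 2 * alpha * nonlocal_slope s.

Lemma mul_sinh_nonneg (s : R) : 0 <= s * sinh s.
Proof.
destruct (Rtotal_order s 0) as [H | [-> | H]].
- generalize (sinh_pos (- s)). rewrite sinh_opp. nra.
- lra.
- generalize (sinh_pos s H). nra.
Qed.

Lemma robin_ge_1 (s : R) : 1 <= robin s.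
Proof.
unfold robin. generalize (cosh_ge_1 s) (mul_sinh_nonneg s). intros H1 H2.
assert (0 <= s * sinh s / (2 * (1 + cosh s)));
  [apply Rcomplements.Rdiv_le_0_compat|]; lra.
Qed.

Lemma is_derive_robin (s : R) :
  is_derive robin s (sinh s + (sinh s + s) / (2 * (1 + cosh s))).
Proof.
unfold robin. generalize (cosh_ge_1 s) (sinh_sq s). intros H1 H2.
auto_derive.
- lra.
- field_simplify_eq; [|lra]. ring [H2].
Qed.

Lemma is_derive_load (alpha s : R) :
  is_derive (load alpha) s
    ((stretch s / robin s + 4 * alpha * s) / (4 * robin s ^ 2)
       * load_slope alpha s).
Proof.
generalize (robin_ge_1 s) (cosh_ge_1 s) (sinh_sq s) (mul_sinh_nonneg s).
intros HD H1 H2 H3.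
assert (Hd := is_derive_robin s).
assert (HD' : Derive robin s = sinh s + (sinh s + s) / (2 * (1 + cosh s)))
  by now apply is_derive_unique.
unfold load, stretch. auto_derive.
- repeat split; try lra; now eexists; apply Hd.
- change (Derive (fun x => robin x) s) with (Derive robin s). rewrite HD'.
  unfold load_slope, local_slope, nonlocal_slope.
  unfold robin in *.
  set (C := cosh s) in *. set (S := sinh s) in *.
  clearbody C S. clear Hd HD'.
  field_simplify_eq; [ring [H2]|].
  split; nra.
Qed.

Lemma decreasing_of_derive (f df : R -> R) (x y : R) :
  (forall t, x <= t <= y -> is_derive f t (df t)) ->
  (forall t, x < t < y -> df t < 0) ->
  x < y -> f y < f x.
Proof.
intros Hd Hneg Hxy. apply Ropp_lt_cancel.
apply (increasing_of_derive (fun t => - f t) (fun t => - df t)); auto.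
- intros t Ht. apply (is_derive_opp f t (df t)), Hd, Ht.
- intros t Ht. specialize (Hneg t Ht). lra.
Qed.

(** In the numerator of the derivative the terms of top degree in
    [cosh t] have the right sign.  The negative ones that carry a factor [t^2]
    are absorbed by [t^2 <= 2 * (cosh t - 1)], after which the factors of
    [sinh t] and of [t] are polynomials in [cosh t], positive on [[1, +oo)]. *)
Lemma local_slope_decreasing (x y : R) :
  0 <= x -> x < y -> local_slope y < local_slope x.
Proof.
intros Hx Hxy.
apply (decreasing_of_derive local_slope (fun t =>
  - (sinh t * (2 * cosh t ^ 4 + 7 * cosh t ^ 3 + 49 / 2 * cosh t ^ 2
               + 33 * cosh t + 27 / 2)
     + t * (2 * cosh t ^ 4 - 11 / 2 * cosh t ^ 3 + 7 * cosh t ^ 2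
               + 59 / 2 * cosh t + 15)
     + t ^ 2 * sinh t * (2 * cosh t ^ 2 - 6 * cosh t - 7 / 2)
     - 3 / 2 * t ^ 3 * cosh t)
  / (2 * cosh t + 2 * cosh t ^ 2 + t * sinh t) ^ 2)); auto.
- intros t Ht. unfold local_slope.
  generalize (cosh_ge_1 t) (sinh_sq t) (mul_sinh_nonneg t). intros H1 H2 H3.
  auto_derive; [nra|].
  set (C := cosh t) in *. set (S := sinh t) in *. clearbody C S.
  field_simplify_eq; [ring [H2]|nra].
- intros t Ht.
  assert (H0 : 0 < t) by lra.
  generalize (cosh_gt_1 t H0) (cosh_gt_quadratic t H0) (sinh_pos t H0)
    (mul_sinh_nonneg t).
  set (C := cosh t) in *. set (S := sinh t) in *. clearbody C S.
  intros H1 H2 H3 H4.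
  unfold Rdiv. rewrite Ropp_mult_distr_l_reverse.
  apply Ropp_lt_gt_0_contravar. apply Rmult_lt_0_compat.
  2: { apply Rinv_0_lt_compat, pow_lt. nra. }
  (* [G1] and [G2] trade the negative terms for polynomials in [C]; [G3] and
     [G4] collect what is left in front of [S] and of [t]. *)
  assert (G1 : t ^ 2 * S * (6 * C + 7 / 2) <= 2 * (C - 1) * S * (6 * C + 7 / 2)).
  { apply Rmult_le_compat_r; [lra|]. apply Rmult_le_compat_r; lra. }
  assert (G2 : t ^ 3 * C <= 2 * (C - 1) * (t * C)).
  { replace (t ^ 3 * C) with (t ^ 2 * (t * C)) by ring.
    apply Rmult_le_compat_r; nra. }
  assert (G3 : 0 < S * (2 * C ^ 4 + 7 * C ^ 3 + 25 / 2 * C ^ 2 + 38 * C + 41 / 2)).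
  { apply Rmult_lt_0_compat; auto.
    assert (0 < C ^ 4) by (apply pow_lt; lra).
    assert (0 < C ^ 3) by (apply pow_lt; lra). nra. }
  assert (G4 : 0 < t * (C ^ 2 * (2 * C ^ 2 - 11 / 2 * C + 4) + 65 / 2 * C + 15)).
  { apply Rmult_lt_0_compat; auto.
    assert (0 < 2 * C ^ 2 - 11 / 2 * C + 4)
      by (generalize (pow2_ge_0 (C - 11 / 8)); lra).
    assert (0 < C ^ 2) by (apply pow_lt; lra). nra. }
  assert (G5 : 0 <= t ^ 2 * S * (2 * C ^ 2)).
  { repeat apply Rmult_le_pos; try lra; nra. }
  nra.
Qed.

(** The numerator of the derivative vanishes to third order at 0, so cubic
    lower bounds are needed: it is expressed through [t * cosh t - sinh t],
    which dominates both [2 * (sinh t - t)] and [t^3 / 3]. *)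
Lemma nonlocal_slope_decreasing (x y : R) :
  0 <= x -> x < y -> nonlocal_slope y < nonlocal_slope x.
Proof.
intros Hx Hxy.
apply (decreasing_of_derive nonlocal_slope (fun t =>
  - ((cosh t + 1) * (t * (cosh t ^ 2 + cosh t + 1 / 2)
                     - sinh t * (cosh t + 3 / 2)) - t ^ 2 * sinh t / 2)
  / (1 + cosh t) ^ 2)); auto.
- intros t Ht. unfold nonlocal_slope.
  generalize (cosh_ge_1 t) (sinh_sq t). intros H1 H2.
  auto_derive; [lra|].
  set (C := cosh t) in *. set (S := sinh t) in *. clearbody C S.
  field_simplify_eq; [ring [H2]|lra].
- intros t Ht.
  assert (H0 : 0 < t) by lra.
  generalize (cosh_gt_1 t H0) (sinh_pos t H0)
   (sinh_lt_mul_cosh t H0) (mul_cosh_sub_sinh_gt_cube t H0)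
   (mul_cosh_sub_sinh_gt_sinh_sub_id t H0).
  set (C := cosh t) in *. set (S := sinh t) in *. clearbody C S.
  intros H1 H2 H3 H4 H5.
  unfold Rdiv. rewrite Ropp_mult_distr_l_reverse.
  apply Ropp_lt_gt_0_contravar. apply Rmult_lt_0_compat.
  2: { apply Rinv_0_lt_compat, pow_lt. lra. }
  assert (G1 : (C + 3 / 4) * (t * C - S)
                 <= t * (C ^ 2 + C + 1 / 2) - S * (C + 3 / 2)) by nra.
  assert (G2 : (C + 1) * ((C + 3 / 4) * (t ^ 3 / 3))
                 <= (C + 1) * ((C + 3 / 4) * (t * C - S))).
  { apply Rmult_le_compat_l; [lra|]. apply Rmult_le_compat_l; lra. }
  assert (G3 : t ^ 2 * S <= t ^ 2 * (t * C)).
  { apply Rmult_le_compat_l; nra. }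
  assert (G4 : 0 < t ^ 3) by (apply pow_lt; lra).
  assert (G5 : 0 < t ^ 3 * ((C + 1) * (C + 3 / 4) / 3 - C / 2)).
  { apply Rmult_lt_0_compat; auto. nra. }
  assert (G6 : (C + 1) * ((C + 3 / 4) * (t * C - S)) <=
    (C + 1) * (t * (C ^ 2 + C + 1 / 2) - S * (C + 3 / 2))).
  { apply Rmult_le_compat_l; lra. }
  lra.
Qed.

Lemma load_slope_decreasing (alpha x y : R) :
  0 <= alpha -> 0 <= x -> x < y -> load_slope alpha y < load_slope alpha x.
Proof.
intros Ha Hx Hxy. unfold load_slope.
generalize (local_slope_decreasing x y Hx Hxy)
  (nonlocal_slope_decreasing x y Hx Hxy). nra.
Qed.

Lemma load_slope_0 (alpha : R) : 0 <= alpha -> 0 < load_slope alpha 0.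
Proof.
intros Ha. unfold load_slope, local_slope, nonlocal_slope.
rewrite cosh_0, sinh_0. lra.
Qed.

Lemma load_slope_4 (alpha : R) : 0 <= alpha -> load_slope alpha 4 < 0.
Proof.
intros Ha.
assert (H4 : 0 < 4) by lra.
generalize (cosh_gt_quadratic 4 H4) (sinh_pos 4 H4) (sinh_sq 4).
unfold load_slope, local_slope, nonlocal_slope.
set (C := cosh 4). set (S := sinh 4). clearbody C S. intros H1 H2 H3.
assert (HS : 1 + C < 2 * S) by nra.
assert (A1 : ((1 + C) * (9 / 2 + C / 2 - C ^ 2)
     - 4 * S * (5 + 2 * C) - 3 / 2 * 4 ^ 2)
  / (2 * C + 2 * C ^ 2 + 4 * S) < 0).
{ apply Rdiv_neg_pos; nra. }
assert (A2 : (2 * C * (1 + C) - 4 * S * (C + 1 / 2) - 4 ^ 2 / 2) / (1 + C) < 0).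
{ apply Rdiv_neg_pos; nra. }
nra.
Qed.

Lemma continuity_of_derive (f df : R -> R) :
  (forall x, is_derive f x (df x)) -> continuity f.
Proof.
intros H x. apply derivable_continuous_pt. exists (df x).
apply is_derive_Reals, H.
Qed.

Lemma continuity_load_slope (alpha : R) : continuity (load_slope alpha).
Proof.
intros x. apply continuity_pt_filterlim.
apply (ex_derive_continuous (load_slope alpha)).
unfold load_slope, local_slope, nonlocal_slope.
generalize (cosh_ge_1 x) (mul_sinh_nonneg x). intros H1 H2.
auto_derive. repeat split; nra.
Qed.

Lemma continuity_load (alpha : R) : continuity (load alpha).
Proof. apply (continuity_of_derive _ _ (is_derive_load alpha)). Qed.

(** The maximum is at the only zero of the decreasing function
    [load_slope alpha], which lies in [[0, 4]]. *)
Lemma load_unimodal (alpha : R) :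
  0 <= alpha ->
  exists top, 0 < top /\
    (forall x y, 0 <= x -> x < y -> y <= top -> load alpha x < load alpha y) /\
    (forall x y, top <= x -> x < y -> load alpha y < load alpha x).
Proof.
intros Ha.
destruct (IVT (fun x => - load_slope alpha x) 0 4) as [top [Htop H0]].
- apply continuity_opp, continuity_load_slope.
- lra.
- generalize (load_slope_0 alpha Ha). lra.
- generalize (load_slope_4 alpha Ha). lra.
- assert (Htop0 : 0 < top).
  { destruct (Req_dec top 0) as [-> |]; [|lra].
    generalize (load_slope_0 alpha Ha). lra. }
  assert (Hpos : forall t, 0 < t ->
    0 < (stretch t / robin t + 4 * alpha * t) / (4 * robin t ^ 2)).
  { intros t Ht. generalize (robin_ge_1 t) (sinh_pos t Ht). intros H1 H2.
    apply Rdiv_lt_0_compat; [|nra].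
    apply Rplus_lt_le_0_compat; [|nra].
    apply Rdiv_lt_0_compat; unfold stretch; lra. }
  exists top. split; [auto|split].
  + intros x y Hx Hxy Hy. eapply increasing_of_derive; auto.
    * intros t _. apply is_derive_load.
    * intros t Ht. apply Rmult_lt_0_compat; [apply Hpos; lra|].
      assert (load_slope alpha top < load_slope alpha t)
        by (apply load_slope_decreasing; lra). lra.
  + intros x y Hx Hxy. eapply decreasing_of_derive; auto.
    * intros t _. apply is_derive_load.
    * intros t Ht. apply Rmult_pos_neg; [apply Hpos; lra|].
      assert (load_slope alpha t < load_slope alpha top)
        by (apply load_slope_decreasing; lra). lra.
Qed.

Lemma load_0 (alpha : R) : load alpha 0 = 0.
Proof.
unfold load, stretch, robin. rewrite sinh_0, cosh_0. field.
Qed.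

Lemma load_pos (alpha x : R) : 0 <= alpha -> 0 < x -> 0 < load alpha x.
Proof.
intros Ha Hx. unfold load. generalize (robin_ge_1 x) (sinh_pos x Hx).
intros H1 H2.
apply Rdiv_lt_0_compat; [|lra]. apply pow_lt.
apply Rplus_lt_le_0_compat; [|nra].
apply Rdiv_lt_0_compat; unfold stretch; lra.
Qed.

(** [robin] grows exponentially while the numerator of [load] is quadratic in
    [s]; the bound [x^4 / 32 < cosh x] is enough for an explicit witness. *)
Lemma load_small (alpha M l : R) :
  0 <= alpha -> 0 <= M -> 0 < l -> exists x, M < x /\ load alpha x < l.
Proof.
intros Ha HM Hl.
set (b := 1 + 2 * alpha).
assert (Hq : 0 <= 16 * b ^ 2 / l).
{ apply Rcomplements.Rdiv_le_0_compat; [generalize (pow2_ge_0 b)|]; lra. }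
exists (M + 1 + 16 * b ^ 2 / l). split; [lra|].
set (x := M + 1 + 16 * b ^ 2 / l).
assert (Hx1 : 1 <= x) by (unfold x; lra).
assert (Hx2 : 16 * b ^ 2 < l * x ^ 2).
{ assert (16 * b ^ 2 < l * x).
  { replace (16 * b ^ 2) with (l * (16 * b ^ 2 / l)) by (field; lra).
    apply Rmult_lt_compat_l; unfold x; lra. }
  assert (l * x <= l * x ^ 2) by (apply Rmult_le_compat_l; nra).
  lra. }
assert (HC : x ^ 4 / 32 < cosh x).
(* Duplication upgrades the quadratic lower bound on [cosh] to a quartic one. *)
{ assert (E : cosh x = 2 * cosh (x / 2) ^ 2 - 1).
  { unfold cosh. replace x with (x / 2 + x / 2) at 1 2 by field.
    rewrite Ropp_plus_distr, !exp_plus, exp_Ropp. field.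
    apply Rgt_not_eq, exp_pos. }
  rewrite E. generalize (cosh_gt_quadratic (x / 2)). nra. }
assert (HD : cosh x <= robin x).
{ unfold robin. generalize (cosh_ge_1 x) (mul_sinh_nonneg x). intros H1 H2.
  assert (0 <= x * sinh x / (2 * (1 + cosh x)));
    [apply Rcomplements.Rdiv_le_0_compat|]; lra. }
assert (HN : 0 <= stretch x / robin x <= 2).
{ generalize (sinh_gt_id x) (sinh_sq x) (cosh_ge_1 x). intros H1 H2 H3.
  assert (H4 : x < sinh x) by (apply H1; lra).
  split.
  - apply Rcomplements.Rdiv_le_0_compat; unfold stretch; lra.
  - apply Rcomplements.Rle_div_l; [lra|]. unfold stretch. nra. }
unfold load.
apply Rcomplements.Rlt_div_l; [generalize (robin_ge_1 x); lra|].
assert (Hy : 0 <= stretch x / robin x + 4 * alpha * x <= 2 * b * x).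
{ unfold b. split; nra. }
set (y := stretch x / robin x + 4 * alpha * x) in *. clearbody y.
assert (y ^ 2 <= (2 * b * x) ^ 2) by (apply pow_incr; lra).
assert (16 * b ^ 2 * x ^ 2 < l * x ^ 2 * x ^ 2)
  by (apply Rmult_lt_compat_r; nra).
assert (l * (x ^ 4 / 32) < l * robin x) by (apply Rmult_lt_compat_l; lra).
nra.
Qed.

(** * The inverse of stretch *)

Lemma stretch_expands (s t : R) : s < t -> t - s < stretch t - stretch s.
Proof. intros H. generalize (sinh_lt s t H). unfold stretch. lra. Qed.

Lemma is_derive_stretch (s : R) : is_derive stretch s (1 + cosh s).
Proof. unfold stretch. derive. Qed.

Lemma stretch_surjective (y : R) : {s : R | stretch s = y}.
Proof.
destruct (IVT_gen stretch (- Rabs y) (Rabs y) y) as [s [_ Hs]].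
- apply (continuity_of_derive _ _ is_derive_stretch).
- assert (H : Rabs y <= stretch (Rabs y)).
  { unfold stretch. destruct (Rabs_pos y) as [H | <-].
    - generalize (sinh_pos _ H). lra.
    - rewrite sinh_0. lra. }
  assert (E : stretch (- Rabs y) = - stretch (Rabs y))
    by (unfold stretch; rewrite sinh_opp; ring).
  rewrite E, Rmin_left, Rmax_right; try (generalize (Rabs_pos y); lra).
  generalize (Rle_abs y) (Rle_abs (- y)). rewrite Rabs_Ropp. lra.
- now exists s.
Qed.

Definition unstretch (y : R) : R := proj1_sig (stretch_surjective y).

Lemma stretch_unstretch (y : R) : stretch (unstretch y) = y.
Proof. apply (proj2_sig (stretch_surjective y)). Qed.

Lemma stretch_injective (s t : R) : stretch s = stretch t -> s = t.
Proof.
intros H. destruct (Rtotal_order s t) as [Hl | [He | Hl]]; auto;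
  generalize (stretch_expands _ _ Hl); lra.
Qed.

Lemma unstretch_stretch (s : R) : unstretch (stretch s) = s.
Proof. apply stretch_injective, stretch_unstretch. Qed.

Lemma unstretch_opp (y : R) : unstretch (- y) = - unstretch y.
Proof.
apply stretch_injective. rewrite stretch_unstretch.
unfold stretch. rewrite sinh_opp.
generalize (stretch_unstretch y). unfold stretch. lra.
Qed.

Lemma unstretch_0 : unstretch 0 = 0.
Proof.
apply stretch_injective. rewrite stretch_unstretch.
unfold stretch. rewrite sinh_0. ring.
Qed.

Lemma unstretch_lt (y z : R) : y < z -> unstretch y < unstretch z.
Proof.
intros H. rewrite <- (stretch_unstretch y), <- (stretch_unstretch z) in H.
destruct (Rlt_le_dec (unstretch y) (unstretch z)) as [|[Hl|He]]; auto.
- generalize (stretch_expands _ _ Hl). lra.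
- rewrite He in H. lra.
Qed.

Lemma continuity_unstretch : continuity unstretch.
Proof.
intros y eps Heps. exists eps. split; auto.
intros z [_ Hz]. simpl in *. unfold R_dist in *.
apply Rle_lt_trans with (2 := Hz).
destruct (Rtotal_order y z) as [H | [-> | H]].
- generalize (unstretch_lt _ _ H). intros H1.
  generalize (stretch_expands _ _ H1). rewrite !stretch_unstretch. intros H2.
  rewrite !Rabs_pos_eq; lra.
- rewrite !Rminus_diag, Rabs_R0. lra.
- generalize (unstretch_lt _ _ H). intros H1.
  generalize (stretch_expands _ _ H1). rewrite !stretch_unstretch. intros H2.
  rewrite !Rabs_left; lra.
Qed.

Lemma is_derive_unstretch (y : R) :
  is_derive unstretch y (/ (1 + cosh (unstretch y))).
Proof.
apply is_derive_Reals.
assert (Prf : forall a, unstretch (y - 1) <= a <= unstretch (y + 1) ->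
          derivable_pt stretch a).
{ intros a _. exists (1 + cosh a). apply is_derive_Reals, is_derive_stretch. }
assert (Hy : unstretch (y - 1) <= unstretch y <= unstretch (y + 1)).
{ split; apply Rlt_le, unstretch_lt; lra. }
assert (E : derive_pt stretch (unstretch y) (Prf _ Hy) = 1 + cosh (unstretch y)).
{ apply derive_pt_eq_0, is_derive_Reals, is_derive_stretch. }
rewrite <- E. rewrite <- Rdiv_1_l.
apply Ranalysis5.derivable_pt_lim_recip_interv; try lra.
- apply continuity_unstretch.
- intros z _. apply stretch_unstretch.
- rewrite E. generalize (cosh_pos (unstretch y)). lra.
Qed.

(** * The explicit profiles *)

(** [profile m c] solves [w'' = (m^3 * c^2 / 8) / w^2] with [w(0) = m] and
    [w'(0) = 0], since [(1 + cosh s) / 2 = cosh(s/2)^2]. *)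
Definition profile (m c y : R) : R := m * (1 + cosh (unstretch (c * y))) / 2.
Definition profile_slope (m c y : R) : R :=
  m * c / 2 * (sinh (unstretch (c * y)) / (1 + cosh (unstretch (c * y)))).

Lemma is_derive_unstretch_scaled (c y : R) :
  is_derive (fun z => unstretch (c * z)) y
    (c / (1 + cosh (unstretch (c * y)))).
Proof.
evar_last.
- apply (is_derive_comp unstretch (fun z => c * z) y).
  + apply is_derive_unstretch.
  + auto_derive; auto.
- unfold scal; simpl; unfold mult; simpl. unfold Rdiv. ring.
Qed.

Lemma is_derive_profile (m c y : R) :
  is_derive (profile m c) y (profile_slope m c y).
Proof.
unfold profile, profile_slope.
evar_last.
- apply (is_derive_comp (fun s => m * (1 + cosh s) / 2)
           (fun z => unstretch (c * z)) y).
  + auto_derive; auto.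
  + apply is_derive_unstretch_scaled.
- unfold scal; simpl; unfold mult; simpl. field.
  generalize (cosh_pos (unstretch (c * y))). lra.
Qed.

Lemma is_derive_profile_slope (m c y : R) :
  is_derive (profile_slope m c) y
    (m * c ^ 2 / 2 / (1 + cosh (unstretch (c * y))) ^ 2).
Proof.
unfold profile_slope.
evar_last.
- apply (is_derive_comp (fun s => m * c / 2 * (sinh s / (1 + cosh s)))
           (fun z => unstretch (c * z)) y).
  + auto_derive; auto.
    generalize (cosh_pos (unstretch (c * y))). lra.
  + apply is_derive_unstretch_scaled.
- unfold scal; simpl; unfold mult; simpl.
  generalize (sinh_sq (unstretch (c * y))) (cosh_pos (unstretch (c * y))).
  set (C := cosh _). set (S := sinh _). clearbody C S. intros H1 H2.
  field_simplify_eq; [ring [H1]|lra].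
Qed.

Lemma profile_pos (m c y : R) : 0 < m -> 0 < profile m c y.
Proof.
intros Hm. unfold profile. generalize (cosh_pos (unstretch (c * y))). nra.
Qed.

(** [1 / w] is a multiple of the derivative of [sigma], because
    [sigma' = c / (1 + cosh sigma)]. *)
Lemma RInt_inv_profile (m c : R) :
  0 < m -> 0 < c ->
  RInt (fun y => / profile m c y) (-1) 1 = 4 * unstretch c / (m * c).
Proof.
intros Hm Hc.
apply is_RInt_unique.
replace (4 * unstretch c / (m * c))
  with (minus (2 / (m * c) * unstretch (c * 1))
          (2 / (m * c) * unstretch (c * - 1))).
- apply (is_RInt_derive (fun y => 2 / (m * c) * unstretch (c * y))).
  + intros y _. evar_last.
    * apply (is_derive_scal (fun z => unstretch (c * z)) y (2 / (m * c))).
      apply is_derive_unstretch_scaled.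
    * unfold profile. field.
      generalize (cosh_pos (unstretch (c * y))). lra.
  + intros y _. apply (ex_derive_continuous (fun y => / profile m c y)).
    eexists. apply is_derive_inv; [apply is_derive_profile|].
    generalize (profile_pos m c y Hm). lra.
- replace (c * - 1) with (- c) by ring. rewrite Rmult_1_r, unstretch_opp.
  unfold minus, plus, opp; simpl. field. lra.
Qed.

Lemma cosh_le_of_abs (s t : R) : Rabs s <= t -> cosh s <= cosh t.
Proof.
intros H.
assert (Ht : 0 <= t) by (generalize (Rabs_pos s); lra).
assert (H1 : forall u v, u <= v -> sinh u <= sinh v).
{ intros u v [Hl | ->]; [apply Rlt_le, sinh_lt, Hl | lra]. }
assert (H2 : sinh s <= sinh t)
  by (apply H1; generalize (Rle_abs s); lra).
assert (H3 : - sinh s <= sinh t).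
{ rewrite <- sinh_opp. apply H1.
  generalize (Rle_abs (- s)). rewrite Rabs_Ropp. lra. }
generalize (sinh_sq s) (sinh_sq t) (cosh_pos s) (cosh_pos t). nra.
Qed.

Lemma profile_le_boundary (m c y : R) :
  0 < m -> 0 < c -> -1 <= y <= 1 -> profile m c y <= profile m c 1.
Proof.
intros Hm Hc Hy. unfold profile.
assert (H : cosh (unstretch (c * y)) <= cosh (unstretch (c * 1))).
{ apply cosh_le_of_abs. apply Rabs_le.
  assert (Hmono : forall u v, u <= v -> unstretch u <= unstretch v).
  { intros u v [Hl | ->]; [apply Rlt_le, unstretch_lt, Hl | lra]. }
  split; [rewrite <- unstretch_opp|]; apply Hmono; nra. }
nra.
Qed.

(** [w + w'] at a point with [sigma = s], and also [w - w'] at a point with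
    [sigma = - s]. *)
Definition boundary_value (m c s : R) : R :=
  m * (1 + cosh s) / 2 + m * c / 2 * (sinh s / (1 + cosh s)).

Lemma boundary_value_increasing (m c s t : R) :
  0 < m -> 0 < c -> 0 <= s -> s < t ->
  boundary_value m c s < boundary_value m c t.
Proof.
intros Hm Hc Hs Hst.
apply (increasing_of_derive (boundary_value m c)
  (fun u => m * sinh u / 2 + m * c / 2 / (1 + cosh u))); auto.
- intros u _. unfold boundary_value.
  generalize (cosh_pos u) (sinh_sq u). intros H1 H2.
  auto_derive; [lra|].
  field_simplify_eq; [ring [H2]|lra].
- intros u Hu. assert (Hu0 : 0 < u) by lra.
  generalize (cosh_pos u) (sinh_pos u Hu0). intros H1 H2.
  assert (0 < m * c / 2 / (1 + cosh u)); [|nra].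
  apply Rdiv_lt_0_compat; nra.
Qed.

Lemma boundary_value_stretch (m s : R) :
  boundary_value m (stretch s) s = m * robin s.
Proof.
unfold boundary_value, stretch, robin.
generalize (cosh_pos s) (sinh_sq s). intros H1 H2.
field_simplify_eq; [ring [H2]|lra].
Qed.

(** The consistency condition between [mu = m^3 * c^2 / 8], the integral of
    [1 / w] and [lambda], solved for [lambda]. *)
Lemma load_profile (alpha m s : R) :
  0 < s -> m * robin s = 1 ->
  load alpha s =
  m ^ 3 * stretch s ^ 2 / 8 * (1 + alpha * (4 * s / (m * stretch s))) ^ 2.
Proof.
intros Hs Hm. generalize (robin_ge_1 s) (sinh_pos s Hs). intros H1 H2.
replace m with (/ robin s)
  by (apply (Rmult_eq_reg_r (robin s)); [rewrite Hm; field|]; lra).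
unfold load. unfold stretch. field. lra.
Qed.

Lemma D_in_of_is_derive (f df : R -> R) (D : R -> Prop) (x : R) :
  is_derive f x (df x) -> D_in f df D x.
Proof.
intros H. apply is_derive_Reals, derivable_pt_lim_D_in in H.
intros eps Heps. destruct (H eps Heps) as [a [Ha Hl]].
exists a. split; auto.
intros z [[_ Hz] Hd]. apply Hl. repeat split; auto.
Qed.

Lemma continue_in_of_continuity_pt (f : R -> R) (D : R -> Prop) (x : R) :
  continuity_pt f x -> continue_in f D x.
Proof.
intros H eps Heps. destruct (H eps Heps) as [a [Ha Hl]].
exists a. split; auto.
intros z [[_ Hz] Hd]. apply Hl. repeat split; auto.
Qed.

Definition deflection (s y : R) : R := 1 - profile (/ robin s) (stretch s) y.

Lemma deflection_solution (alpha s : R) :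
  0 <= alpha -> 0 < s -> is_solution alpha (load alpha s) (deflection s).
Proof.
intros Ha Hs.
generalize (robin_ge_1 s) (sinh_pos s Hs). intros HD HS.
assert (Hc : 0 < stretch s) by (unfold stretch; lra).
assert (Hm : 0 < / robin s) by (apply Rinv_0_lt_compat; lra).
assert (Hmr : / robin s * robin s = 1) by (field; lra).
assert (HI : RInt (fun y => / (1 - deflection s y)) (-1) 1
             = 4 * s / (/ robin s * stretch s)).
{ transitivity (4 * unstretch (stretch s) / (/ robin s * stretch s));
    [|now rewrite unstretch_stretch].
  rewrite <- (RInt_inv_profile _ _ Hm Hc).
  apply RInt_ext. intros y _. unfold deflection. f_equal. ring. }
unfold is_solution. rewrite HI, (load_profile alpha (/ robin s)); auto.
assert (Hb := boundary_value_stretch (/ robin s) s). rewrite Hmr in Hb.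
unfold deflection in *.
set (m := / robin s) in *. set (c := stretch s) in *.
assert (Ec : unstretch c = s) by apply unstretch_stretch.
assert (Hb1 : profile m c 1 + profile_slope m c 1 = 1).
{ unfold profile, profile_slope. rewrite Rmult_1_r, Ec. exact Hb. }
assert (Hsl : 0 < profile_slope m c 1).
{ unfold profile_slope. rewrite Rmult_1_r, Ec.
  apply Rmult_lt_0_compat; [nra|].
  apply Rdiv_lt_0_compat; auto. generalize (cosh_pos s). lra. }
exists (fun y => - profile_slope m c y),
  (fun y => - (m * c ^ 2 / 2 / (1 + cosh (unstretch (c * y))) ^ 2)).
split; [|split; [|split; [|split]]].
- intros x _. split; [|split].
  + apply D_in_of_is_derive. evar_last.
    * apply (is_derive_minus (fun _ => 1) (profile m c)).
      -- apply is_derive_const.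
      -- apply is_derive_profile.
    * unfold minus, plus, opp, zero; simpl. ring.
  + apply D_in_of_is_derive.
    apply (is_derive_opp (profile_slope m c)), is_derive_profile_slope.
  + apply continue_in_of_continuity_pt, continuity_pt_filterlim.
    apply (ex_derive_continuous
      (fun y => - (m * c ^ 2 / 2 / (1 + cosh (unstretch (c * y))) ^ 2))).
    assert (ex_derive (fun y => unstretch (c * y)) x)
      by (eexists; apply is_derive_unstretch_scaled).
    apply (ex_derive_comp (fun t => - (m * c ^ 2 / 2 / (1 + cosh t) ^ 2))
      (fun y => unstretch (c * y))); auto.
    generalize (cosh_pos (unstretch (c * x))). intros H1.
    auto_derive. nra.
- intros x Hx. generalize (profile_pos m c x Hm)
    (profile_le_boundary m c x Hm Hc Hx). lra.
- intros x _.
  replace (1 - (1 - profile m c x)) with (profile m c x) by ring.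
  unfold profile. generalize (cosh_pos (unstretch (c * x))).
  set (C := cosh _). intros H1. rewrite Ropp_involutive.
  assert (0 <= alpha * (4 * s / (m * c))).
  { apply Rmult_le_pos; auto. apply Rcomplements.Rdiv_le_0_compat; nra. }
  field. repeat split; try lra. nra.
- lra.
- replace (profile m c (-1)) with (profile m c 1).
  replace (profile_slope m c (-1)) with (- profile_slope m c 1). lra.
  + unfold profile_slope. replace (c * -1) with (- (c * 1)) by ring.
    rewrite unstretch_opp, sinh_opp, cosh_opp. field.
    generalize (cosh_pos (unstretch (c * 1))). lra.
  + unfold profile. replace (c * -1) with (- (c * 1)) by ring.
    now rewrite unstretch_opp, cosh_opp.
Qed.

(** * Every positive solution is a profile *)

Lemma constant_of_derive (f : R -> R) (x y : R) :
  (forall t, -1 < t < 1 -> is_derive f t 0) ->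
  (forall t, dom t -> continuity_pt f t) ->
  dom x -> dom y -> f x = f y.
Proof.
intros Hd Hc [Hx1 Hx2] [Hy1 Hy2].
destruct (MVT_gen f x y (fun _ => 0)) as [t [_ Ht]].
- intros t [H1 H2]. apply Hd. split.
  + apply Rle_lt_trans with (2 := H1). now apply Rmin_glb.
  + apply Rlt_le_trans with (1 := H2). now apply Rmax_lub.
- intros t [H1 H2]. apply Hc. split.
  + apply Rle_trans with (2 := H1). now apply Rmin_glb.
  + apply Rle_trans with (1 := H2). now apply Rmax_lub.
- lra.
Qed.

Lemma hyperbolic_log_ratio (u : R) :
  -1 < u < 1 ->
  let s := ln ((1 + u) / (1 - u)) in
  cosh s = (1 + u ^ 2) / (1 - u ^ 2) /\ sinh s = 2 * u / (1 - u ^ 2).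
Proof.
intros Hu s.
assert (H : 0 < (1 + u) / (1 - u)) by (apply Rdiv_lt_0_compat; lra).
unfold cosh, sinh. rewrite exp_Ropp. unfold s. rewrite exp_ln; auto.
split; field; repeat split; try lra; nra.
Qed.

(** By conservation of energy, [u = w' / v] with [v^2 = 2 * mu / m] satisfies
    [w * (1 - u^2) = m].  Hence [u] is in [(-1, 1)] and
    [sigma = ln((1 + u) / (1 - u))] is defined and differentiable also where
    [w' = 0], unlike a [sigma] obtained by solving [w = m * cosh(sigma/2)^2].
    The derivative of [stretch sigma] is then the constant [2 * v / m]; thus
    no uniqueness theorem for differential equations is needed. *)
Lemma solution_is_profile (mu : R) (W W1 : R -> R) :
  0 < mu -> continuity W -> continuity W1 ->
  (forall x, -1 < x < 1 -> is_derive W x (W1 x)) ->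
  (forall x, -1 < x < 1 -> is_derive W1 x (mu / W x ^ 2)) ->
  (forall x, 0 < W x) -> W1 (-1) < 0 -> 0 < W1 1 ->
  exists m c x0, 0 < m /\ 0 < c /\ dom x0 /\ mu = m ^ 3 * c ^ 2 / 8 /\
    forall x, dom x ->
      W x = profile m c (x - x0) /\ W1 x = profile_slope m c (x - x0).
Proof.
intros Hmu HW HW1 HdW HdW1 Hpos Hl Hr.
destruct (IVT W1 (-1) 1) as [x0 [Hx0 H0]]; auto; [lra|].
assert (Hm := Hpos x0). set (m := W x0) in *.
set (v := sqrt (2 * mu / m)).
assert (Hv2 : 2 * mu / m = v ^ 2).
{ unfold v. rewrite pow2_sqrt; auto.
  apply Rlt_le, Rdiv_lt_0_compat; lra. }
assert (Hv : 0 < v) by (apply sqrt_lt_R0, Rdiv_lt_0_compat; lra).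
assert (Emu : mu = m * v ^ 2 / 2) by (rewrite <- Hv2; field; lra).
assert (HnW : forall x, W x <> 0) by (intros x; apply Rgt_not_eq, Hpos).
assert (HE : forall x, dom x -> W1 x ^ 2 / 2 + mu / W x = mu / m).
{ intros x Hx.
  replace (mu / m) with (W1 x0 ^ 2 / 2 + mu / W x0)
    by (rewrite H0; fold m; field; lra).
  apply (constant_of_derive (fun t => W1 t ^ 2 / 2 + mu / W t)); auto.
  - intros t Ht. assert (A1 := HdW t Ht). assert (A2 := HdW1 t Ht).
    auto_derive.
    + repeat split; auto; eexists; eassumption.
    + change (Derive (fun x => W x) t) with (Derive W t).
      change (Derive (fun x => W1 x) t) with (Derive W1 t).
      rewrite (is_derive_unique _ _ _ A1), (is_derive_unique _ _ _ A2).
      field. auto.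
  - intros t _. apply continuity_pt_plus; [|apply continuity_pt_div].
    + apply (continuity_pt_comp W1 (fun z => z ^ 2 / 2)); auto.
      apply derivable_continuous_pt. exists (W1 t). apply is_derive_Reals.
      auto_derive; auto. field.
    + apply continuity_pt_const. now intros ? ?.
    + apply HW.
    + auto. }
set (u := fun x => W1 x / v).
assert (Hu : forall x, dom x -> W x * (1 - u x ^ 2) = m).
{ intros x Hx. specialize (HE x Hx). specialize (Hpos x). specialize (HnW x).
  assert (E1 : W1 x ^ 2 = v ^ 2 * (1 - m / W x)).
  { rewrite Emu in HE. apply (Rmult_eq_reg_r (/ 2)); [|lra].
    transitivity (m * v ^ 2 / 2 / m - m * v ^ 2 / 2 / W x); [lra|].
    field. lra. }
  unfold u. replace ((W1 x / v) ^ 2) with (W1 x ^ 2 / v ^ 2) by (field; lra).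
  rewrite E1. field. lra. }
assert (Hu1 : forall x, dom x -> -1 < u x < 1).
{ intros x Hx. specialize (Hu x Hx). specialize (Hpos x).
  assert (0 < 1 - u x ^ 2) by (apply Rmult_lt_reg_l with (W x); lra).
  nra. }
set (sigma := fun x => ln ((1 + u x) / (1 - u x))).
assert (Hst : forall x, dom x ->
  stretch (sigma x) = ln ((1 + u x) / (1 - u x)) + 2 * u x / (1 - u x ^ 2)).
{ intros x Hx. unfold stretch, sigma.
  now rewrite (proj2 (hyperbolic_log_ratio (u x) (Hu1 x Hx))). }
(* [psi (u x)] is [stretch (sigma x)], written as a function of [u] so that
   its derivative is rational. *)
set (psi := fun z => ln ((1 + z) / (1 - z)) + 2 * z / (1 - z ^ 2)).
assert (Hpsi : forall z, -1 < z < 1 -> is_derive psi z (4 / (1 - z ^ 2) ^ 2)).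
{ intros z Hz. unfold psi.
  assert (0 < (1 + z) / (1 - z)) by (apply Rdiv_lt_0_compat; lra).
  auto_derive.
  - repeat split; auto; try lra; nra.
  - field. repeat split; try lra; nra. }
set (c := 2 * v / m).
assert (Hc : 0 < c) by (apply Rdiv_lt_0_compat; lra).
assert (Hlin : forall x, dom x -> sigma x = unstretch (c * (x - x0))).
{ intros x Hx. apply stretch_injective.
  rewrite stretch_unstretch, Hst; auto.
  assert (E : psi (u x) - c * x = psi (u x0) - c * x0).
  { apply (constant_of_derive (fun t => psi (u t) - c * t)); auto.
    - intros t Ht. assert (Hdt : dom t) by (unfold dom; lra).
      evar_last.
      + apply (is_derive_minus (fun t => psi (u t)) (fun t => c * t)).
        * apply (is_derive_comp psi u); [apply Hpsi; auto|].
          unfold u. apply (is_derive_ext (fun t => / v * W1 t));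
            [intros z; apply Rmult_comm|].
          apply (is_derive_scal W1 t (/ v)). apply HdW1; auto.
        * apply (is_derive_scal id t c), is_derive_id.
      + unfold minus, plus, opp, scal, one; simpl; unfold mult; simpl.
        specialize (Hu t Hdt). specialize (HnW t). specialize (Hu1 t Hdt).
        assert (H1 : 1 - u t ^ 2 = m / W t)
          by (rewrite <- Hu; field; auto).
        replace (1 - u t * (u t * 1)) with (m / W t) by (rewrite <- H1; ring).
        unfold c. rewrite Emu. field. repeat split; auto; lra.
    - intros t Ht. apply continuity_pt_minus.
      + apply (continuity_pt_comp u psi).
        * apply continuity_pt_div; auto; [|lra].
          apply continuity_pt_const. now intros ? ?.
        * apply derivable_continuous_pt. eexists. apply is_derive_Reals.
          apply Hpsi; auto.
      + apply derivable_continuous_pt. exists c. apply is_derive_Reals.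
        auto_derive; auto. ring. }
  assert (Ez : psi (u x0) = 0).
  { unfold psi, u. rewrite H0.
    replace ((1 + 0 / v) / (1 - 0 / v)) with 1 by (field; lra).
    rewrite ln_1. field. lra. }
  change (psi (u x) = c * (x - x0)). lra. }
exists m, c, x0. split; [|split; [|split; [|split]]]; auto.
- unfold c. rewrite Emu. field. lra.
- intros x Hx. unfold profile, profile_slope. rewrite <- Hlin; auto.
  destruct (hyperbolic_log_ratio (u x) (Hu1 x Hx)) as [E1 E2].
  unfold sigma. rewrite E1, E2. specialize (Hu x Hx). specialize (Hu1 x Hx).
  split.
  + rewrite <- Hu. field. nra.
  + replace (W1 x) with (v * u x) by (unfold u; field; lra).
    unfold c. field. repeat split; try lra; nra.
Qed.

(** * Classification of the solutions *)

(** Composition with [clamp] extends a function from [[-1, 1]] to a function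
    continuous on the whole line, so that one-sided continuity at the end points
    becomes ordinary continuity. *)
Definition clamp (x : R) : R := Rmax (-1) (Rmin x 1).

Lemma clamp_dom (x : R) : dom (clamp x).
Proof.
unfold dom, clamp. split; [apply Rmax_l|].
apply Rmax_lub; [lra|apply Rmin_r].
Qed.

Lemma clamp_id (x : R) : dom x -> clamp x = x.
Proof.
intros [H1 H2]. unfold clamp. rewrite Rmin_left, Rmax_right; auto.
Qed.

Lemma clamp_contracts (x y : R) : Rabs (clamp x - clamp y) <= Rabs (x - y).
Proof.
unfold clamp, Rmax, Rmin, Rabs.
repeat destruct Rle_dec; repeat destruct Rcase_abs; lra.
Qed.

Lemma continuity_clamp (f : R -> R) :
  (forall x, dom x -> continue_in f dom x) ->
  continuity (fun x => f (clamp x)).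
Proof.
intros H x eps Heps.
destruct (H (clamp x) (clamp_dom x) eps Heps) as [a [Ha Hl]].
exists a. split; auto.
intros y [_ Hy]. simpl in *. unfold R_dist in *.
destruct (Req_dec (clamp x) (clamp y)) as [-> | Hne].
- rewrite Rminus_diag, Rabs_R0. exact Heps.
- apply Hl. split; [split; [apply clamp_dom | exact Hne]|].
  apply Rle_lt_trans with (2 := Hy), clamp_contracts.
Qed.

Lemma is_derive_clamp (f df : R -> R) (x : R) :
  -1 < x < 1 -> D_in f df dom x ->
  is_derive (fun y => f (clamp y)) x (df x).
Proof.
intros Hx H.
apply is_derive_Reals. intros eps Heps.
destruct (H eps Heps) as [a [Ha Hl]].
assert (Hd : 0 < Rmin a (Rmin (x + 1) (1 - x))).
{ repeat apply Rmin_glb_lt; lra. }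
exists (mkposreal _ Hd). intros h Hh0 Hh. simpl in Hh.
apply Rmin_Rgt in Hh as [Hh1 Hh2]. apply Rmin_Rgt in Hh2 as [Hh2 Hh3].
assert (Hxh : dom (x + h)).
{ apply Rabs_def2 in Hh2, Hh3. unfold dom. lra. }
rewrite !clamp_id; [|unfold dom; lra|exact Hxh].
replace h with (x + h - x) at 2 by ring.
apply Hl. split; [split; [exact Hxh | lra]|].
simpl. unfold R_dist. replace (x + h - x) with h by ring. exact Hh1.
Qed.

(** Since [w + w'] at 1 and [w - w'] at -1 are the same increasing function
    of [sigma(1)] and [- sigma(-1)], the boundary conditions force the minimum
    to be at 0. *)
Lemma solution_is_deflection (alpha lambda : R) (U : R -> R) :
  0 <= alpha -> 0 < lambda -> is_solution alpha lambda U ->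
  exists s, 0 < s /\ load alpha s = lambda /\ eq_on_dom U (deflection s).
Proof.
intros Ha Hl (dU & ddU & HC2 & Hrange & Heq & Hbr & Hbl).
set (W := fun x => 1 - U (clamp x)).
set (W1 := fun x => - dU (clamp x)).
assert (HW : continuity W).
{ apply continuity_minus; [apply continuity_const; now intros ? ?|].
  apply continuity_clamp. intros x Hx. apply cont_deriv with dU, HC2, Hx. }
assert (HW1 : continuity W1).
{ apply continuity_opp, continuity_clamp. intros x Hx.
  apply cont_deriv with ddU, (HC2 x Hx). }
assert (Hpos : forall x, 0 < W x).
{ intros x. unfold W. generalize (Hrange _ (clamp_dom x)). lra. }
assert (HWU : forall x, dom x -> W x = 1 - U x).
{ intros x Hx. unfold W. now rewrite clamp_id. }
assert (HI : RInt (fun y => / (1 - U y)) (-1) 1 = RInt (fun y => / W y) (-1) 1).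
{ apply RInt_ext. rewrite Rmin_left, Rmax_right by lra. intros y Hy.
  rewrite HWU; [reflexivity | unfold dom; lra]. }
rewrite HI in Heq. clear HI.
assert (HI0 : 0 <= RInt (fun y => / W y) (-1) 1).
{ apply RInt_ge_0; [lra| |].
  - apply (ex_RInt_continuous (fun y => / W y)). intros z _.
    apply continuity_pt_filterlim, (continuity_pt_inv W); auto.
    apply Rgt_not_eq, Hpos.
  - intros y _. apply Rlt_le, Rinv_0_lt_compat, Hpos. }
set (I := RInt (fun y => / W y) (-1) 1) in *.
assert (HaI : 1 <= 1 + alpha * I) by nra.
set (mu := lambda / (1 + alpha * I) ^ 2).
assert (Hmu : 0 < mu) by (apply Rdiv_lt_0_compat; nra).
assert (D1 : dom 1) by (unfold dom; lra).
assert (D2 : dom (-1)) by (unfold dom; lra).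
assert (Er : W 1 + W1 1 = 1) by (unfold W, W1; rewrite clamp_id; auto; lra).
assert (El : W (-1) - W1 (-1) = 1) by (unfold W, W1; rewrite clamp_id; auto; lra).
destruct (solution_is_profile mu W W1) as (m & c & x0 & Hm & Hc & Hx0 & Emu & Hp);
  auto.
- intros x Hx. assert (Hdx : dom x) by (unfold dom; lra).
  evar_last.
  + apply (is_derive_minus (fun _ => 1) (fun y => U (clamp y)));
      [apply is_derive_const|].
    apply (is_derive_clamp U dU x Hx), HC2, Hdx.
  + unfold W1, minus, plus, opp, zero; simpl. rewrite clamp_id; auto. ring.
- intros x Hx. assert (Hdx : dom x) by (unfold dom; lra).
  evar_last.
  + apply (is_derive_opp (fun y => dU (clamp y))).
    apply (is_derive_clamp dU ddU x Hx), (HC2 x Hdx).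
  + change (- ddU x = mu / W x ^ 2). rewrite (Heq x Hx), HWU; auto.
    unfold mu. generalize (Hrange x Hdx). intros H. field. lra.
- generalize (Hrange _ D2) (HWU _ D2). lra.
- generalize (Hrange _ D1) (HWU _ D1). lra.
- assert (Br : boundary_value m c (unstretch (c * (1 - x0))) = 1).
  { transitivity (W 1 + W1 1); [|exact Er]. now destruct (Hp 1 D1) as [-> ->]. }
  assert (Bl : boundary_value m c (unstretch (c * (1 + x0))) = 1).
  { transitivity (W (-1) - W1 (-1)); [|exact El]. destruct (Hp (-1) D2) as [-> ->].
    unfold boundary_value, profile, profile_slope.
    replace (c * (-1 - x0)) with (- (c * (1 + x0))) by ring.
    rewrite unstretch_opp, cosh_opp, sinh_opp. field.
    generalize (cosh_pos (unstretch (c * (1 + x0)))). lra. }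
  assert (Hnn : forall y, 0 <= y -> 0 <= unstretch y).
  { intros y [Hy | <-].
    - apply Rlt_le. rewrite <- unstretch_0. now apply unstretch_lt.
    - rewrite unstretch_0. lra. }
  unfold dom in Hx0.
  assert (N1 : 0 <= unstretch (c * (1 - x0))) by (apply Hnn; nra).
  assert (N2 : 0 <= unstretch (c * (1 + x0))) by (apply Hnn; nra).
  assert (E0 : x0 = 0).
  { destruct (Rtotal_order x0 0) as [H | [H | H]]; auto.
    - assert (H1 : c * (1 + x0) < c * (1 - x0)) by nra.
      apply unstretch_lt in H1.
      generalize (boundary_value_increasing m c _ _ Hm Hc N2 H1). lra.
    - assert (H1 : c * (1 - x0) < c * (1 + x0)) by nra.
      apply unstretch_lt in H1.
      generalize (boundary_value_increasing m c _ _ Hm Hc N1 H1). lra. }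
  subst x0.
  set (s := unstretch c).
  assert (Hs : 0 < s) by (rewrite <- unstretch_0; now apply unstretch_lt).
  assert (Ec : c = stretch s) by (symmetry; apply stretch_unstretch).
  assert (Hmr : m * robin s = 1).
  { rewrite <- boundary_value_stretch, <- Ec.
    replace (c * (1 - 0)) with c in Br by ring. exact Br. }
  assert (HWp : forall x, dom x -> W x = profile m c x).
  { intros x Hx. rewrite (proj1 (Hp x Hx)). f_equal. ring. }
  exists s. split; [auto|split].
  + rewrite (load_profile alpha m s Hs Hmr), <- Ec.
    assert (EI : I = 4 * s / (m * c)).
    { unfold s. rewrite <- RInt_inv_profile; auto.
      apply RInt_ext. rewrite Rmin_left, Rmax_right by lra. intros y Hy.
      rewrite HWp; [reflexivity | unfold dom; lra]. }
    rewrite <- EI, <- Emu. unfold mu. field. lra.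
  + intros x Hx. unfold deflection. rewrite <- Ec.
    replace (/ robin s) with m.
    * rewrite <- HWp, HWU; auto. ring.
    * generalize (robin_ge_1 s). intros H.
      apply (Rmult_eq_reg_r (robin s)); [rewrite Hmr; field|]; lra.
Qed.

Lemma robin_increasing (s t : R) : 0 <= s -> s < t -> robin s < robin t.
Proof.
intros Hs Hst.
eapply increasing_of_derive; auto.
- intros u _. apply is_derive_robin.
- intros u Hu. assert (H0 : 0 < u) by lra.
  generalize (sinh_pos u H0) (cosh_pos u). intros H1 H2.
  apply Rplus_lt_0_compat; auto. apply Rdiv_lt_0_compat; lra.
Qed.

(** Different parameters give different minima [1 / robin s] of [w] at 0. *)
Lemma deflection_distinct (s t : R) :
  0 <= s -> s < t -> ~ eq_on_dom (deflection s) (deflection t).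
Proof.
intros Hs Hst H.
assert (D0 : dom 0) by (unfold dom; lra).
specialize (H 0 D0). revert H. unfold deflection, profile.
rewrite !Rmult_0_r, unstretch_0, cosh_0.
generalize (robin_ge_1 s) (robin_increasing s t Hs Hst). intros H1 H2.
assert (/ robin t < / robin s) by (apply Rinv_lt_contravar; nra).
lra.
Qed.

(** * Counting the solutions *)

Theorem theorem1p1 :
  forall alpha : R, 0 <= alpha ->
  exists lambda_star : R, 0 < lambda_star /\
    forall lambda : R, 0 < lambda ->
      (lambda < lambda_star -> exactly_two_solutions (is_solution alpha lambda)) /\
      (lambda = lambda_star -> exactly_one_solution (is_solution alpha lambda)) /\
      (lambda_star < lambda -> no_solution (is_solution alpha lambda)).
Proof.
intros alpha Ha.
destruct (load_unimodal alpha Ha) as (top & Htop & Hup & Hdown).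
exists (load alpha top). split; [now apply load_pos|].
intros lambda Hl. split; [|split].
- intros Hlt.
  (* One root of [load alpha s = lambda] on each side of the maximum. *)
  destruct (IVT (fun s => load alpha s - lambda) 0 top) as [s1 [Hs1 E1]]; auto.
  { apply continuity_minus; [apply continuity_load|].
    apply continuity_const. now intros ? ?. }
  { rewrite load_0. lra. }
  { lra. }
  destruct (load_small alpha top lambda Ha) as [b [Hb Hbl]]; [lra|auto|].
  destruct (IVT (fun s => lambda - load alpha s) top b) as [s2 [Hs2 E2]]; auto.
  { apply continuity_minus; [|apply continuity_load].
    apply continuity_const. now intros ? ?. }
  { lra. }
  { lra. }
  assert (L1 : load alpha s1 = lambda) by lra.
  assert (L2 : load alpha s2 = lambda) by lra.
  assert (P1 : 0 < s1).
  { destruct (Req_dec s1 0) as [H | H]; [|lra]. rewrite H, load_0 in L1. lra. }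
  assert (H1 : s1 < top).
  { destruct (Req_dec s1 top) as [H | H]; [|lra]. rewrite H in L1. lra. }
  assert (H2 : top < s2).
  { destruct (Req_dec s2 top) as [H | H]; [|lra]. rewrite H in L2. lra. }
  exists (deflection s1), (deflection s2). split; [|split; [|split]].
  + rewrite <- L1. now apply deflection_solution.
  + rewrite <- L2. apply deflection_solution; lra.
  + apply deflection_distinct; lra.
  + intros V HV.
    destruct (solution_is_deflection alpha lambda V Ha Hl HV) as (s & Hs & L & E).
    destruct (Rle_lt_dec s top) as [Hst | Hst].
    * left. replace s1 with s; auto.
      destruct (Rtotal_order s s1) as [H | [H | H]]; auto.
      -- assert (load alpha s < load alpha s1) by (apply Hup; lra). lra.
      -- assert (load alpha s1 < load alpha s) by (apply Hup; lra). lra.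
    * right. replace s2 with s; auto.
      destruct (Rtotal_order s s2) as [H | [H | H]]; auto.
      -- assert (load alpha s2 < load alpha s) by (apply Hdown; lra). lra.
      -- assert (load alpha s < load alpha s2) by (apply Hdown; lra). lra.
- intros ->. exists (deflection top). split; [now apply deflection_solution|].
  intros V HV.
  destruct (solution_is_deflection _ _ V Ha Hl HV) as (s & Hs & L & E).
  replace top with s; auto.
  destruct (Rtotal_order s top) as [H | [H | H]]; auto.
  + assert (load alpha s < load alpha top) by (apply Hup; lra). lra.
  + assert (load alpha s < load alpha top) by (apply Hdown; lra). lra.
- intros Hgt V HV.
  destruct (solution_is_deflection _ _ V Ha Hl HV) as (s & Hs & L & E).
  destruct (Rtotal_order s top) as [H | [-> | H]]; try lra.
  + assert (load alpha s < load alpha top) by (apply Hup; lra). lra.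
  + assert (load alpha s < load alpha top) by (apply Hdown; lra). lra.
Qed.
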